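(* The set of positions which have Sprague-Grundy value $1$ in $\mathcal{F}$-Wythoff is $$\{(0,1)\}\cup\{(\lfloor \phi n \rfloor+2,\ \lfloor \phi^2 n \rfloor +2) \mid n \in \mathbb{Z},\ n\geq 0 \}.$$
   Context: $\phi = (1+\sqrt5)/2$ and $\lfloor\cdot\rfloor$ is the integer part. A position is an unordered pair $(a,b)$ of nonnegative integers (two piles of tokens); $(a,b)$ is identified with $(b,a)$. $\mathcal{F}$-Wythoff is the impartial game with the following legal moves: (i) remove any positive number of tokens from one pile; (ii) remove the same positive number $k$ of tokens from both piles, provided the integer ratio of the two entries does not change, i.e. from $(a,b)$ with $1\le a\le b$ one may move to $(a-k,b-k)$ with $1\le k<a$ if $\lfloor (b-k)/(a-k)\rfloor=\lfloor b/a\rfloor$. The followers of $p$ are the positions reachable from $p$ by one legal move. For a finite set $S$ of nonnegative integers, $\mathrm{mex}(S)$ is the smallest nonnegative integer not in $S$ (so $\mathrm{mex}\,\emptyset=0$). The Sprague-Grundy value is defined inductively by $\mathcal{G}(p)=\mathrm{mex}\{\mathcal{G}(q)\mid q \text{ is a follower of } p\}$. *)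

(* Defs.v *)
From HB Require Import structures.
From mathcomp Require Import all_boot all_order all_algebra.
From mathcomp Require Import classical_sets reals.
From mathcomp Require Import zify.

Set Implicit Arguments.
Unset Strict Implicit.
Unset Printing Implicit Defensive.

(* An unordered pair of naturals is represented by its sorted ordered pair. *)
Record position := Position {
  piles : nat * nat;
  piles_sorted : piles.1 <= piles.2 }.

HB.instance Definition _ := [isSub for piles].
HB.instance Definition _ := [Choice of position by <:].

Fact minn_le_maxn (a b : nat) : (minn a b, maxn a b).1 <= (minn a b, maxn a b).2.
Proof. by rewrite /=; lia. Qed.

Definition pos (a b : nat) : position := Position (minn_le_maxn a b).

Lemma posC (a b : nat) : pos a b = pos b a.
Proof. by apply: val_inj; rewrite /= minnC maxnC. Qed.

Lemma pos_piles (p : position) : pos (piles p).1 (piles p).2 = p.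
Proof.
by apply: val_inj; case: p => -[a b] /= ab; congr (_, _); lia.
Qed.

(* [pos] being symmetric, [take_one] covers both piles. *)
Inductive follower : position -> position -> Prop :=
| take_one (a b k : nat) :
    0 < k <= a -> follower (pos a b) (pos (a - k) b)
| take_both (a b k : nat) :
    1 <= a <= b -> 1 <= k < a -> (b - k) %/ (a - k) = b %/ a ->
    follower (pos a b) (pos (a - k) (b - k)).

Definition followers (p : position) : seq position :=
  let: (a, b) := piles p in
  [seq pos (a - k) b | k <- iota 1 a]
  ++ [seq pos a (b - k) | k <- iota 1 b]
  ++ [seq pos (a - k) (b - k)
       | k <- iota 1 a.-1 & (b - k) %/ (a - k) == b %/ a].

Lemma followersP (p q : position) : reflect (follower p q) (q \in followers p).
Proof.
apply: (iffP idP).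
  rewrite -{2}[p]pos_piles /followers; case: p => -[a b] /= ab.
  rewrite !mem_cat => /or3P[] /mapP[k].
  - by rewrite mem_iota => k_in ->; apply: take_one; lia.
  - rewrite mem_iota => k_in ->; rewrite (posC a b) (posC a (b - k)).
    by apply: take_one; lia.
  - rewrite mem_filter mem_iota => /andP[/eqP ratio k_in] ->.
    by apply: take_both => //; lia.
case=> {p q} [a b k k_in | a b k ab k_in ratio]; rewrite /followers /= !mem_cat.
  have [le_ab | lt_ba] := leqP a b.
  - apply/orP; left; apply/mapP; exists k; first by rewrite mem_iota; lia.
    by [].
  - apply/orP; right; apply/orP; left; apply/mapP; exists k.
      by rewrite mem_iota; lia.
    by rewrite posC.
have -> : minn a b = a by lia.
have -> : maxn a b = b by lia.
apply/orP; right; apply/orP; right; apply/mapP; exists k => //.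
by rewrite mem_filter ratio eqxx mem_iota; lia.
Qed.

Fact mex_subproof (s : seq nat) : exists n, n \notin s.
Proof.
exists (\max_(i <- s) i).+1; apply/negP => /(@leq_bigmax_seq _ s xpredT id).
by move=> /(_ isT); rewrite ltnn.
Qed.

Definition mex (s : seq nat) : nat := ex_minn (mex_subproof s).

(* Structural recursion on a bound on the number of moves left;
   [grundyE] is the defining recursion. *)
Fixpoint grundy_rec (fuel : nat) (p : position) : nat :=
  if fuel is n.+1 then mex [seq grundy_rec n q | q <- followers p] else 0.

Definition tokens (p : position) : nat := (piles p).1 + (piles p).2.

Definition grundy (p : position) : nat := grundy_rec (tokens p).+1 p.

Lemma tokens_follower (p q : position) : follower p q -> tokens q < tokens p.
Proof. by case=> *; rewrite /tokens /=; lia. Qed.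

Lemma grundy_rec_fuel (m n : nat) (p : position) :
  tokens p < m -> tokens p < n -> grundy_rec m p = grundy_rec n p.
Proof.
elim: m n p => [|m IHm] [|n] p //= pm pn; congr mex.
by apply/eq_in_map => q /followersP /tokens_follower qp; apply: IHm; lia.
Qed.

Lemma grundyE (p : position) : grundy p = mex [seq grundy q | q <- followers p].
Proof.
rewrite {1}/grundy /=; congr mex; apply/eq_in_map => q.
by move=> /followersP /tokens_follower qp; apply: grundy_rec_fuel.
Qed.

Definition phi (R : realType) : R := ((1 + Num.sqrt 5) / 2)%R.

(* Main.v *)
(* For a shift c >= 1 the pairs (floor(phi n) + c, floor(phi^2 n) + c) form a
   kernel of the positions whose piles both have at least c tokens: by Beatty's
   theorem every integer > c is an entry of exactly one of them, and every
   difference occurs exactly once. The diagonal moves that this requires keep the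
   ratio equal to 1. A diagonal move never empties a pile, so no shifted pair
   leads to (0,0) for c = 1, nor to (0,1) for c = 2; adding these positions to
   the kernels yields the positions of value 0 and of value 1. *)
Require Import Defs.
From mathcomp Require Import all_boot all_order all_algebra.
From mathcomp Require Import boolp classical_sets reals.
From mathcomp Require Import zify ring lra.

Set Implicit Arguments.
Unset Strict Implicit.
Unset Printing Implicit Defensive.

Import Order.TTheory GRing.Theory Num.Theory.

(** * Beatty's theorem for phi and phi^2, in integer arithmetic *)

(* Descent: if m / n is the golden ratio, then so is n / (m - n). *)
Lemma golden_irrational (m n : nat) : m * m = m * n + n * n -> n = 0.
Proof.
have [k] := ubnP n; elim: k m n => // k IHk m n lt_nk mn.
case: (posnP n) => // n_gt0.
have lt_nm : n < m by nia.
have lt_m2n : m < 2 * n by nia.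
have /IHk : n * n = n * (m - n) + (m - n) * (m - n) by nia.
by lia.
Qed.

Definition lower_wythoff (R : realType) (n : nat) : nat :=
  Num.truncn (phi R * n%:R)%R.

Lemma phi_sqr (R : realType) : (phi R ^+ 2 = phi R + 1)%R.
Proof.
have sqrt5 : (Num.sqrt 5 ^+ 2 = 5 :> R)%R by rewrite sqr_sqrtr ?ler0n.
by rewrite /phi; move: (Num.sqrt _) sqrt5 => s s5; lra.
Qed.

Lemma phi_gt0 (R : realType) : (0 < phi R)%R.
Proof. by rewrite divr_gt0 ?ltr_wpDr ?sqrtr_ge0. Qed.

(** The form m^2 - m n - n^2 factors as (m - phi n)(m + (phi - 1) n), so its sign compares m with
    phi n. This reduces later questions about the floor to integer inequalities. *)
Lemma leq_lower_wythoff (R : realType) (m n : nat) :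
  (m <= lower_wythoff R n) = (m * m <= m * n + n * n).
Proof.
have f0 := phi_gt0 R; have f2 := phi_sqr R.
have fn0 : (0 <= phi R * n%:R)%R by apply: mulr_ge0 => //; apply: ltW.
rewrite /lower_wythoff (truncn_ge_nat _ fn0).
rewrite -(ler_nat R) natrD !natrM.
move: (phi R) f0 f2 {fn0} => f f0 f2.
have m0 : (0 <= m%:R :> R)%R by [].
have n0 : (0 <= n%:R :> R)%R by [].
have -> : (m%:R * m%:R <= m%:R * n%:R + n%:R * n%:R :> R)%R
        = (0 <= (f * n%:R - m%:R) * (m%:R + (f - 1) * n%:R))%R.
  have -> : ((f * n%:R - m%:R) * (m%:R + (f - 1) * n%:R)
     = m%:R * n%:R + n%:R * n%:R - m%:R * m%:R
       + (f ^+ 2 - f - 1) * n%:R * n%:R)%R by ring.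
  rewrite f2; have -> : (f + 1 - f - 1 = 0)%R by ring.
  by rewrite !mul0r addr0 subr_ge0.
have f1 : (1 < f)%R by nra.
(* The conjugate factor vanishes at m = n = 0, so n = 0 is treated apart. *)
case: (posnP n) => [->|n_gt0].
  by rewrite !mulr0 addr0 sub0r mulNr oppr_ge0; apply/idP/idP => ?; nra.
have n0' : (0 < n%:R :> R)%R by rewrite ltr0n.
have conj_gt0 : (0 < m%:R + (f - 1) * n%:R)%R.
  by rewrite ltr_wpDl // mulr_gt0 // subr_gt0.
by rewrite (pmulr_lge0 _ conj_gt0) subr_ge0.
Qed.

Lemma upper_wythoffE (R : realType) (n : nat) :
  Num.truncn (phi R ^+ 2 * n%:R)%R = lower_wythoff R n + n.
Proof.
have fn0 : (0 <= phi R * n%:R)%R by apply: mulr_ge0 => //; apply/ltW/phi_gt0.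
by rewrite phi_sqr mulrDl mul1r addrC truncnD ?natr_nat // natrK addnC.
Qed.

Lemma lower_wythoff0 (R : realType) : lower_wythoff R 0 = 0.
Proof. by have := leq_lower_wythoff R 1 0; lia. Qed.

Lemma lower_wythoff_lt (R : realType) : {homo lower_wythoff R : m n / m < n}.
Proof.
apply: homo_ltn; first exact: ltn_trans.
move=> n; rewrite leq_lower_wythoff.
have := leq_lower_wythoff R (lower_wythoff R n) n; rewrite leqnn => /esym.
by nia.
Qed.

Lemma lower_wythoff_inj (R : realType) : injective (lower_wythoff R).
Proof.
by move=> m n mn; case: (ltngtP m n) => // /(lower_wythoff_lt R); lia.
Qed.

Lemma leq_lower_wythoff_id (R : realType) (n : nat) : n <= lower_wythoff R n.
Proof. by rewrite leq_lower_wythoff; lia. Qed.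

(** The substitution (l, j) -> (l + j, l) changes the sign of the quadratic form. Hence l < phi j <
    l + 1 puts m = l + j strictly between the lower entries of the consecutive indices l and l +
    1. *)
Lemma lower_upper_wythoff_disjoint (R : realType) (n j : nat) :
  lower_wythoff R n = lower_wythoff R j + j -> n = 0.
Proof.
set m := lower_wythoff R n; set l := lower_wythoff R j => mE.
case: (posnP n) => // n_gt0.
have m_gt0 : 0 < m by have := leq_lower_wythoff_id R n; lia.
have := leq_lower_wythoff R l j; rewrite leqnn => /esym lj.
have := leq_lower_wythoff R l.+1 j; rewrite ltnn => /esym lj1.
have j_gt0 : 0 < j.
  by case: (posnP j) mE => // j0; rewrite /l j0 lower_wythoff0; lia.
(* Irrationality makes l < phi j strict. *)
have lj_neq : l * l <> l * j + j * j by move/golden_irrational; lia.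
have lt_lm : lower_wythoff R l < m by rewrite ltnNge leq_lower_wythoff; nia.
have lt_ml : m < lower_wythoff R l.+1 by rewrite leq_lower_wythoff; nia.
have : l < n.
  rewrite ltnNge; apply/negP; rewrite leq_eqVlt => /orP[/eqP nl|].
    by move: lt_lm; rewrite -nl -/m; lia.
  by move/(lower_wythoff_lt R); lia.
rewrite leq_eqVlt => /orP[/eqP nl|]; first by move: lt_ml; rewrite nl -/m; lia.
by move/(lower_wythoff_lt R); lia.
Qed.

Lemma lower_upper_wythoff_cover (R : realType) (m : nat) :
  (exists n, m = lower_wythoff R n) \/ (exists n, m = lower_wythoff R n + n).
Proof.
have ex_n : exists n, m <= lower_wythoff R n.
  by exists m; apply: leq_lower_wythoff_id.
have [n le_m_n min_n] := ex_minnP ex_n.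
case: n => [|l] in le_m_n min_n *.
  by left; exists 0; move: le_m_n; rewrite lower_wythoff0; lia.
have lt_lm : lower_wythoff R l < m by rewrite ltnNge; apply/negP=> /min_n; lia.
move: le_m_n; rewrite leq_eqVlt => /orP[/eqP ->|lt_ml]; first by left; exists l.+1.
(* Here m lies strictly between the lower entries of indices l and l + 1. By the same sign change, l
   is the lower entry of index m - l. *)
right; exists (m - l).
have le_lm : l <= m by have := leq_lower_wythoff_id R l; lia.
move: lt_lm lt_ml; rewrite ltnNge !leq_lower_wythoff => lt_lm lt_ml.
have m_neq : m.+1 * m.+1 <> m.+1 * l.+1 + l.+1 * l.+1 by move/golden_irrational.
have : l <= lower_wythoff R (m - l) by rewrite leq_lower_wythoff; nia.
have : ~~ (l < lower_wythoff R (m - l)) by rewrite leq_lower_wythoff; nia.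
lia.
Qed.

(** * Level sets of the Sprague-Grundy function as kernels *)

Lemma grundy_eqP (p : position) (k : nat) :
  grundy p = k <-> k <= grundy p /\ (forall q, follower p q -> grundy q <> k).
Proof.
have inP j : j \in [seq grundy q | q <- followers p] <->
             exists2 q, follower p q & grundy q = j.
  split=> [/mapP[q /followersP pq ->] | [q /followersP pq <-]]; first by exists q.
  exact: map_f.
rewrite grundyE /mex; case: ex_minnP => n /negP n_notin min_n; split.
  by move=> <-; split=> // q pq qn; apply/n_notin/inP; exists q.
move=> [le_kn not_k]; apply/eqP; rewrite eqn_leq le_kn andbT; apply: min_n.
by apply/negP => /inP[q /not_k].
Qed.

(** Among the positions of value at least k, those of value k form a kernel, and induction on the
    number of tokens shows that a kernel is unique. *)
Lemma grundy_level_set (k : nat) (P : position -> Prop) :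
  (forall p, P p -> k <= grundy p) ->
  (forall p q, P p -> follower p q -> ~ P q) ->
  (forall p, ~ P p -> k <= grundy p -> exists2 q, follower p q & P q) ->
  forall p, grundy p = k <-> P p.
Proof.
move=> above indep absorb p.
have [t] := ubnP (tokens p); elim: t p => // t IHt p lt_pt.
have IH q : follower p q -> grundy q = k <-> P q.
  by move=> /tokens_follower qp; apply: IHt; lia.
split=> [gp | Pp].
  apply: contrapT => /absorb[|q pq Pq]; first by rewrite gp.
  by have /grundy_eqP[_ /(_ q pq)] := gp; apply; apply/(IH q pq).
apply/grundy_eqP; split=> [|q pq]; first exact: above.
by move/(IH q pq); apply: indep pq.
Qed.

(** * Shifted Wythoff pairs: independence and absorption *)

Definition shifted_wythoff (R : realType) (c : nat) (p : position) : Prop :=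
  exists n, p = pos (lower_wythoff R n + c) (lower_wythoff R n + n + c).

Lemma pos_inj (a b a' b' : nat) : pos a b = pos a' b' ->
  (a = a' /\ b = b') \/ (a = b' /\ b = a').
Proof. by move/(congr1 piles) => /= [? ?]; lia. Qed.

Lemma shifted_wythoff_indep (R : realType) (c : nat) (p q : position) :
  shifted_wythoff R c p -> follower p q -> ~ shifted_wythoff R c q.
Proof.
move=> [n pE] pq [m qE].
have := tokens_follower pq; rewrite {1}pE {1}qE /tokens /= => lt_mn.
(* A move lowers the token count, so it cannot join a pair to itself. A diagonal move preserves the
   difference, which is the index. *)
suff nm : n = m by rewrite nm ltnn in lt_mn.
have dis1 := @lower_upper_wythoff_disjoint R n m.
have dis2 := @lower_upper_wythoff_disjoint R m n.
have A0 := lower_wythoff0 R.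
case: pq pE qE => {p q lt_mn} [a b k k_in|a b k ab k_in _] /pos_inj pE /pos_inj qE;
  last by lia.
(* The untouched pile is an entry of both pairs, lower or upper in each. *)
have [/lower_wythoff_inj //|[An|[Am|AB]]] :
  lower_wythoff R n = lower_wythoff R m \/
  lower_wythoff R n = lower_wythoff R m + m \/
  lower_wythoff R m = lower_wythoff R n + n \/
  lower_wythoff R n + n = lower_wythoff R m + m by lia.
- by have n0 := dis1 An; move: An; rewrite n0 A0; lia.
- by have m0 := dis2 Am; move: Am; rewrite m0 A0; lia.
- by case: (ltngtP n m) => // /[dup] ? /(lower_wythoff_lt R); lia.
Qed.

Lemma follower_lower_max (a b b' : nat) : b' < b -> follower (pos a b) (pos a b').
Proof.
move=> lt_b'b; rewrite (posC a b) (posC a b') -(subKn (ltnW lt_b'b)).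
by apply: take_one; lia.
Qed.

Lemma shifted_wythoff_absorb (R : realType) (c a b : nat) :
  0 < c <= a -> a <= b -> ~ shifted_wythoff R c (pos a b) ->
  exists2 q, follower (pos a b) q & shifted_wythoff R c q.
Proof.
move=> /andP[c_gt0 le_ca] le_ab not_ab.
have [[n aE]|[n aE]] := lower_upper_wythoff_cover R (a - c); last first.
  have {}aE : a = lower_wythoff R n + n + c by lia.
  (* For n = 0 both entries equal c, and b = a is excluded because (a, b) would be that pair. *)
  have lt_b : lower_wythoff R n + c < b.
    case: (posnP n) => [n0|]; last by lia.
    case: (ltngtP b a) => [||ab]; [lia | lia |].
    by case: not_ab; exists n; congr pos; lia.
  exists (pos a (lower_wythoff R n + c)); first exact: follower_lower_max.
  by exists n; rewrite posC aE.
have {}aE : a = lower_wythoff R n + c by lia.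
have le_n := leq_lower_wythoff_id R n.
case: (ltngtP b (lower_wythoff R n + n + c)) => [lt_b|gt_b|bE]; last first.
- by case: not_ab; exists n; rewrite aE bE.
- exists (pos a (lower_wythoff R n + n + c)); first exact: follower_lower_max.
  by exists n; rewrite aE.
(* The larger pile is too small for the partner of a, so the target is the earlier pair with the
   same difference d. *)
pose d := b - a; have lt_dn : d < n by rewrite /d; lia.
have lt_An := lower_wythoff_lt R lt_dn.
have le_d := leq_lower_wythoff_id R d.
exists (pos (lower_wythoff R d + c) (lower_wythoff R d + d + c)); last by exists d.
pose k := lower_wythoff R n - lower_wythoff R d.
have -> : lower_wythoff R d + c = a - k by lia.
have -> : lower_wythoff R d + d + c = b - k by lia.
(* The difference d is smaller than the lower pile at both ends: d < n <= a at the start, and d <=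
   [lower_wythoff R d] with c > 0 at the target. *)
have ratio1 x y : x <= y < x + x -> y %/ x = 1.
  by move=> xy; rewrite -(subnKC (proj1 (andP xy))) divnDl // divnn divn_small; lia.
by apply: take_both; rewrite ?ratio1; lia.
Qed.

(** * The exceptional positions and the values 0 and 1 *)

Lemma follower00 (q : position) : ~ follower (pos 0 0) q.
Proof. by move/followersP. Qed.

Lemma follower01 (q : position) : follower (pos 0 1) q -> q = pos 0 0.
Proof. by move/followersP; rewrite inE => /eqP. Qed.

(** Taking from one pile leaves the other above c, and a diagonal move leaves both piles
    nonempty. *)
Lemma not_follower_to0 (a b c : nat) :
  c < a -> c < b -> ~ follower (pos a b) (pos 0 c).
Proof.
move=> lt_ca lt_cb; move pE: (pos a b) => p; move qE: (pos 0 c) => q pq.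
by case: pq pE qE => [x y k k_in|x y k xy k_in _] /pos_inj pE /pos_inj qE; lia.
Qed.

Lemma shifted_wythoffN0 (R : realType) (c b : nat) :
  0 < c -> ~ shifted_wythoff R c (pos 0 b).
Proof. by move=> c_gt0 [n /pos_inj]; lia. Qed.

Lemma grundy_eq0 (R : realType) (p : position) :
  grundy p = 0 <-> p = pos 0 0 \/ shifted_wythoff R 1 p.
Proof.
move: p; apply: grundy_level_set => [// | p q | p].
- move=> [-> /follower00 //|p_in] pq [qE|q_in]; last exact: shifted_wythoff_indep p_in pq q_in.
  by case: p_in pq => n ->; rewrite qE; apply: not_follower_to0; lia.
- rewrite -(pos_piles p); move: (piles_sorted p).
  move: (piles p).1 (piles p).2 => a b le_ab /not_orP[not_00 not_in] _.
  case: (posnP a) => [a0|a_gt0].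
    exists (pos 0 0); last by left.
    rewrite a0; apply: follower_lower_max.
    by case: (posnP b) => // b0; case: not_00; rewrite a0 b0.
  have [|q] := @shifted_wythoff_absorb R 1 a b _ le_ab not_in; first by lia.
  by exists q => //; right.
Qed.

Lemma grundy_eq1 (R : realType) (p : position) :
  grundy p = 1 <-> p = pos 0 1 \/ shifted_wythoff R 2 p.
Proof.
move: p; apply: grundy_level_set => [p | p q | p].
- rewrite lt0n => p_in; apply/eqP => /(grundy_eq0 R) p0; case: p_in p0 => [->|[n ->]].
    by case=> [/pos_inj|/shifted_wythoffN0]; lia.
  case=> [/pos_inj|[m /pos_inj nm]]; first by lia.
  (* Equal pairs have equal differences, hence equal indices, and then the shifts 1 and 2
     disagree. *)
  by have mn : m = n; [lia | move: nm; rewrite mn; lia].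
- move=> [->|p_in] pq [qE|q_in].
  + by have := follower01 pq; rewrite qE => /pos_inj; lia.
  + by move: q_in; rewrite (follower01 pq); apply: shifted_wythoffN0.
  + by case: p_in pq => n ->; rewrite qE; apply: not_follower_to0; lia.
  + exact: shifted_wythoff_indep p_in pq q_in.
- rewrite -(pos_piles p); move: (piles_sorted p).
  move: (piles p).1 (piles p).2 => a b le_ab /not_orP[not_01 not_in].
  rewrite lt0n => /eqP not0.
  (* If the smaller pile is 0 or 1, every position moves to (0,1) except (0,1) itself and (0,0),
     which has value 0. *)
  case: (leqP 2 a) => [a_ge2|a_lt2].
    have [|q] := @shifted_wythoff_absorb R 2 a b _ le_ab not_in; first by lia.
    by exists q => //; right.
  exists (pos 0 1); last by left.
  case: a => [|[|//]] in a_lt2 le_ab not_01 not_in not0 *.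
    apply: follower_lower_max.
    case: b => [|[|//]] in le_ab not_01 not_in not0 *; last by case: not_01.
    by case: not0; apply/(grundy_eq0 R); left.
  rewrite (posC 0 1); by apply: follower_lower_max; lia.
Qed.

Local Open Scope classical_set_scope.
Local Open Scope ring_scope.

Theorem theorem7 (R : realType) :
  [set p : position | grundy p = 1%N] =
  [set pos 0 1] `|`
  [set pos (Num.truncn (phi R * n%:R) + 2) (Num.truncn (phi R ^+ 2 * n%:R) + 2)
    | n in [set: nat]].
Proof.
apply/seteqP; split=> p /=.
  case/(grundy_eq1 R) => [|[n ->]]; first by left.
  by right; exists n => //; rewrite upper_wythoffE.
move=> p_in; apply/(grundy_eq1 R); case: p_in => [|[n _ <-]]; first by left.
by right; exists n; rewrite upper_wythoffE.
Qed.
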